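(* There exist functions $\psi,\phi\in L^\infty_{loc}(\mathbb{R})$ such that $S_{2+\varepsilon}(\psi,\phi)=\infty$ for every $\varepsilon>0$, while the commutator $[\phi,[\psi,H]]$ is bounded on $L^2(\mathbb{R})$, where $H$ is the Hilbert transform.
   Context: The Hilbert transform is $Hf(x)=\lim_{\varepsilon\to0}\int_{|x-y|>\varepsilon}\frac{f(y)}{x-y}\,dy$. $[A,B]=AB-BA$, and a function acts by pointwise multiplication; the commutator is defined on $L^\infty_c(\mathbb{R})$ and bounded on $L^2$ means $\|[\phi,[\psi,H]]f\|_{2}\le K\|f\|_2$ for all $f\in L^\infty_c$. For $r>0$, with $\langle g\rangle_I=\frac1{|I|}\int_Ig$ and supremum over all intervals $I$: $S_r(b_1,b_2)=\sup_I\big(\frac1{|I|}\int_I|b_1-\langle b_1\rangle_I|^r\big)^{1/r}\big(\frac1{|I|}\int_I|b_2-\langle b_2\rangle_I|^r\big)^{1/r}$. *)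

(* Defs.v *)
From HB Require Import structures.
From mathcomp Require Import all_boot all_order all_algebra.
From mathcomp Require Import all_classical all_reals all_analysis.
Set Implicit Arguments. Unset Strict Implicit. Unset Printing Implicit Defensive.
Import Order.TTheory GRing.Theory Num.Theory.
Import numFieldNormedType.Exports.
Local Open Scope classical_set_scope.
Local Open Scope ring_scope.

Section Defs.
Variable R : realType.
Local Notation mu := (@lebesgue_measure R).

Definition Linf_loc (f : R -> R) : Prop :=
  measurable_fun setT f /\
  forall a b : R, exists M : R,
    {ae mu, forall x, x \in `[a, b] -> `|f x| <= M}.

Definition Linf_c (f : R -> R) : Prop :=
  measurable_fun setT f /\
  (exists M : R, {ae mu, forall x, `|f x| <= M}) /\
  (exists a b : R, forall x, x \notin `[a, b] -> f x = 0).

Definition hilbert (f : R -> R) (x : R) : R :=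
  lim ((fun eps : R =>
          Rintegral mu [set y | eps < `|x - y|] (fun y => f y / (x - y)))
       @ 0^'+).

Definition commH (psi : R -> R) (f : R -> R) : R -> R :=
  fun x => psi x * hilbert f x - hilbert (fun y => psi y * f y) x.

Definition commH2 (phi psi : R -> R) (f : R -> R) : R -> R :=
  fun x => phi x * commH psi f x - commH psi (fun y => phi y * f y) x.

Definition avg (b : R -> R) (a c : R) : R :=
  (c - a)^-1 * Rintegral mu `[a, c] b.

Definition osc (r : R) (b : R -> R) (a c : R) : R :=
  ((c - a)^-1 * Rintegral mu `[a, c] (fun x => `|b x - avg b a c| `^ r))
    `^ r^-1.

Definition S_r (r : R) (b1 b2 : R -> R) : \bar R :=
  ereal_sup [set v : \bar R | exists a c : R,
             a < c /\ v = ((osc r b1 a c * osc r b2 a c)%:E)].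

Definition bounded_L2_on_Linf_c (T : (R -> R) -> (R -> R)) : Prop :=
  exists K : R, forall f, Linf_c f ->
    (Lnorm mu 2%:E (EFin \o T f) <= K%:E * Lnorm mu 2%:E (EFin \o f))%E.

End Defs.

(* Main.v *)
(** If [phi] and [psi] are in [L^2] and their supports are at distance at least
    [c > 0] from each other, then [phi * psi = 0] and the commutator is
    [- phi H(psi f) - psi H(phi f)]. On the support of [phi] the kernel of
    [H(psi f)] is bounded by [c^-1], so Cauchy-Schwarz bounds [H(psi f)] by
    [c^-1 |psi|_2 |f|_2], and symmetrically: the commutator is bounded on [L^2].

    The oscillations are made infinite by spikes: [psi] has a spike at the left
    end, and [phi] one in the middle, of each interval [[k, k + 1]]. The heights
    [h k] and widths [w k] are such that [h k ^+ 2 * w k] is summable, which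
    puts [psi] and [phi] in [L^2], while [h k `^ (2 + eps) * w k] tends to
    infinity for every [eps > 0]. As each function also vanishes on a set of
    measure [w k] of [[k, k + 1]], its mean there is at distance at least
    [h k / 2] from [0] or from [h k], so the oscillation is at least
    [h k / 2 * w k `^ (2 + eps)^-1]. *)
Require Import Defs.
From mathcomp Require Import all_boot all_order all_algebra.
From mathcomp Require Import all_classical all_reals all_analysis.
From mathcomp Require Import measurable_realfun ring lra.
Set Implicit Arguments. Unset Strict Implicit. Unset Printing Implicit Defensive.
Import Order.TTheory GRing.Theory Num.Theory.
Import numFieldNormedType.Exports.
Local Open Scope classical_set_scope.
Local Open Scope ring_scope.

Lemma measurable_invr (R : realType) : measurable_fun setT (@GRing.inv R).
Proof.
rewrite -(setvU [set 0]); apply/measurable_funU => //; first exact: measurableC.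
split; last exact: measurable_fun_set1.
apply: open_continuous_measurable_fun; first exact/closed_openC/closed_eq.
by move=> x; rewrite inE/= => /eqP x0; exact: inv_continuous.
Qed.

Lemma measurable_truncn (R : realType) : measurable_fun setT (@Num.truncn R).
Proof.
move=> _ A _; rewrite setTI.
have -> : @Num.truncn R @^-1` A = \bigcup_(k in A) (Num.truncn @^-1` [set k]).
  by apply/seteqP; split=> [x Ax|x [k Ak /= ->]//]; exists (Num.truncn x).
apply: bigcup_measurable => k _.
pose below m := [set x : R | (Num.truncn x < m)%N].
have mbelow m : measurable (below m).
  case: m => [|m]; first by rewrite (_ : below 0%N = set0)// -subset0 => x.
  have -> : below m.+1 = [set` `]-oo, m.+1%:R[].
    by apply/seteqP; split=> x; rewrite /below/= in_itv/= ltnS truncn_le_nat.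
  exact: measurable_itv.
have -> : @Num.truncn R @^-1` [set k] = below k.+1 `\` below k.
  apply/seteqP; split=> [x /= <-|x []]; rewrite /below/= ltnS.
    by rewrite ltnn.
  by move=> xk /negP; rewrite -leqNgt => kx; apply/eqP; rewrite eqn_leq xk.
exact: measurableD.
Qed.

Section piecewise.
Context d (T : measurableType d) (g : T -> nat).
Hypothesis mg : measurable_fun setT g.

Let fiber k := g @^-1` [set k].

Let measurable_fiber k : measurable (fiber k).
Proof. by rewrite -[fiber k]setTI; exact: mg. Qed.

Let bigcup_fiber : \bigcup_k fiber k = [set: T].
Proof. by apply/seteqP; split=> // x _; exists (g x). Qed.

Lemma measurable_fun_piecewise d' (U : measurableType d') (F : nat -> T -> U) :
  (forall k, measurable_fun setT (F k)) ->
  measurable_fun setT (fun x => F (g x) x).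
Proof.
move=> mF; rewrite -bigcup_fiber; apply/measurable_fun_bigcup => // k.
apply: (eq_measurable_fun (F k)); last exact: measurable_funTS.
by move=> x; rewrite inE => ->.
Qed.

Lemma ge0_integral_piecewise (R : realType) (mu : {measure set T -> \bar R})
    (F : nat -> T -> \bar R) :
  (forall k, measurable_fun setT (F k)) -> (forall k x, (0 <= F k x)%E) ->
  (\int[mu]_x F (g x) x = \sum_(k <oo) \int[mu]_(x in g @^-1` [set k]) F k x)%E.
Proof.
move=> mF F0; rewrite -bigcup_fiber ge0_integral_bigcup//.
- by apply: eq_eseriesr => k _; apply: eq_integral => x; rewrite inE => ->.
- by rewrite bigcup_fiber; exact: measurable_fun_piecewise.
- exact: trivIset_preimage1.
Qed.

End piecewise.

(* [f] need not be measurable: the measurability of the commutator is never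
   proved, only a pointwise upper bound. *)
Lemma ge0_le_integral_nonmeasurable d (T : measurableType d) (R : realType)
    (mu : {measure set T -> \bar R}) (f g : T -> \bar R) :
  (forall x, 0 <= f x)%E -> (forall x, f x <= g x)%E ->
  (\int[mu]_x f x <= \int[mu]_x g x)%E.
Proof.
move=> f0 fg; have g0 x : (0 <= g x)%E by exact: le_trans (fg x).
rewrite !ge0_integralTE//; apply: ereal_sup_le => _ /= [s sf <-].
by exists s => // x; exact: le_trans (fg x).
Qed.

Lemma le_Lnorm d (T : measurableType d) (R : realType)
    (mu : {measure set T -> \bar R}) (p : R) (f g : T -> \bar R) :
  0 < p -> (forall x, `|f x| <= `|g x|)%E ->
  ('N[mu]_p%:E[f] <= 'N[mu]_p%:E[g])%E.
Proof.
move=> p0 fg; rewrite unlock; apply: gt0_ler_poweR.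
- by rewrite invr_ge0 ltW.
- by rewrite in_itv/= leey andbT integral_ge0// => x _; exact: poweR_ge0.
- by rewrite in_itv/= leey andbT integral_ge0// => x _; exact: poweR_ge0.
apply: ge0_le_integral_nonmeasurable => x; first by rewrite poweR_ge0.
by apply: gt0_ler_poweR; rewrite ?in_itv/= ?leey ?abse_ge0 ?(ltW p0) ?fg.
Qed.

Section Lfun_extra.
Context d (T : measurableType d) (R : realType).
Variable mu : {measure set T -> \bar R}.
Implicit Types (f : T -> R) (r : R) (p : \bar R).

Lemma integral_powR_lty_Lfun r f : 0 < r -> measurable_fun setT f ->
  (\int[mu]_x (`|f x| `^ r)%:E < +oo)%E -> f \in Lfun mu r%:E.
Proof.
move=> r0 mf intf; rewrite inE; apply/andP; split; rewrite inE//=.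
by rewrite /finite_norm unlock; exact: poweR_lty.
Qed.

Lemma measurable_Lfun p f : f \in Lfun mu p -> measurable_fun setT f.
Proof. by move=> /sub_Lfun_mfun; rewrite inE. Qed.

Lemma fineK_Lnorm p f : f \in Lfun mu p ->
  (fine 'N[mu]_p[EFin \o f])%:E = ('N[mu]_p[EFin \o f])%E.
Proof.
move=> /sub_Lfun_finLfun; rewrite inE => fin.
by rewrite fineK// ge0_fin_numE ?Lnorm_ge0.
Qed.

End Lfun_extra.

Section local_integrability.
Variable R : realType.
Local Notation mu := (@lebesgue_measure R).
Implicit Types (f b : R -> R) (a c m p r : R).

Lemma measurable_powR_norm f r : measurable_fun setT f ->
  measurable_fun setT (fun x => `|f x| `^ r).
Proof.
move=> mf; apply: (measurableT_comp (measurable_powR r)).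
exact: measurableT_comp.
Qed.

Lemma Linf_loc_integrable_powR b a c m r : 0 <= r -> Linf_loc b ->
  mu.-integrable `[a, c] (EFin \o (fun x => `|b x - m| `^ r)).
Proof.
move=> r0 [mb /(_ a c)[M bM]].
have mdist : measurable_fun `[a, c] (EFin \o (fun x => `|b x - m| `^ r)).
  apply/measurable_EFinP/measurable_funTS.
  by apply: measurable_powR_norm; exact: measurable_funB.
have mu_ac : (mu `[a, c] < +oo)%E.
  by rewrite lebesgue_measure_itv/=; case: ifP => // _; rewrite -EFinB ltry.
apply/integrableP; split=> //.
apply: le_lt_trans (integral_le_bound ((`|M| + `|m|) `^ r)%:E _ _ _ _) _ => //.
- apply: (filterS (Filter := ae_filter_ringOfSetsType mu)) bM => x bM /bM {}bM.
  rewrite /= lee_fin ger0_norm ?powR_ge0//.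
  rewrite ge0_ler_powR ?nnegrE ?addr_ge0//.
  by rewrite (le_trans (ler_normB _ _))// lerD2r (le_trans bM)// ler_norm.
- by rewrite lte_mul_pinfty// lee_fin powR_ge0.
Qed.

Lemma Linf_c_Linf_loc f : Linf_c f -> Linf_loc f.
Proof.
move=> [mf [[M fM] _]]; split=> // a c; exists M.
exact: (filterS (Filter := ae_filter_ringOfSetsType mu)) fM.
Qed.

Lemma Linf_c_Lfun f p : 0 < p -> Linf_c f -> f \in Lfun mu p%:E.
Proof.
move=> p0 /[dup] /Linf_c_Linf_loc floc [mf [_ [a [c supp]]]].
apply: integral_powR_lty_Lfun => //.
have -> : (fun x => (`|f x| `^ p)%:E) =
    (fun x => (`|f x - 0| `^ p)%:E) \_ `[a, c].
  apply/funext => x; rewrite patchE subr0; case: ifPn => // xac.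
  rewrite supp ?normr0 ?powR0 ?gt_eqF//.
  by apply: contra xac; rewrite inE.
rewrite -integral_mkcond.
have /integrableP[_] := Linf_loc_integrable_powR a c 0 (ltW p0) floc.
by under [X in (X < _)%E -> _]eq_integral => x _ do
  rewrite /= ger0_norm ?powR_ge0//.
Qed.

End local_integrability.

Section commutator_separated.
Variable R : realType.
Local Notation mu := (@lebesgue_measure R).
Local Notation norm2 f := (fine 'N[mu]_2%:E[EFin \o f]).
Implicit Types (u v f phi psi : R -> R) (x y c : R).

Lemma hilbert_off_support u x c : 0 < c ->
  (forall y, `|x - y| < c -> u y = 0) ->
  hilbert u x = \int[mu]_y (u y / (x - y)).
Proof.
move=> c0 u0; rewrite /hilbert; apply: norm_lim_near_cst; near=> e.
rewrite Rintegral_mkcond; apply: eq_Rintegral => y _.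
rewrite patchE; case: ifPn => //; rewrite notin_setE/= => /negP.
rewrite -leNgt => xye; rewrite u0 ?mul0r//.
rewrite (le_lt_trans xye)//; near: e; exact: nbhs_right_lt.
Unshelve. all: by end_near. Qed.

Lemma hilbert0 x : hilbert (fun=> 0) x = 0.
Proof.
rewrite (@hilbert_off_support _ _ 1)//.
by under eq_Rintegral do rewrite mul0r; rewrite Rintegral_cst// mul0r.
Qed.

Lemma norm_hilbert_le u x c : 0 < c ->
  (forall y, `|x - y| < c -> u y = 0) -> mu.-integrable setT (EFin \o u) ->
  `|hilbert u x| <= c^-1 * \int[mu]_y `|u y|.
Proof.
move=> c0 u0 iu; rewrite (hilbert_off_support c0 u0).
have kernel_le y : `|u y / (x - y)| <= c^-1 * `|u y|.
  have [xyc|cxy] := ltP `|x - y| c; first by rewrite u0// !mul0r normr0 mulr0.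
  by rewrite normrM normfV mulrC ler_wpM2r// lef_pV2// posrE (lt_le_trans c0).
have iau : mu.-integrable setT (EFin \o (fun y => `|u y|)).
  exact: integrable_abse iu.
have icu : mu.-integrable setT (EFin \o (fun y => c^-1 * `|u y|)).
  exact: (integrableZl measurableT c^-1 iau).
have ik : mu.-integrable setT (EFin \o (fun y => u y / (x - y))).
  apply: le_integrable icu => //.
    have measurable_u : measurable_fun setT u.
      by apply/measurable_EFinP; case/integrableP: iu.
    apply/measurable_EFinP; apply: measurable_funM => //.
    by apply: (measurableT_comp (@measurable_invr R)); exact: measurable_funB.
  by move=> y _ /=; rewrite lee_fin (le_trans (kernel_le y))// ler_norm.
rewrite (le_trans (le_normr_Rintegral _ ik))// -RintegralZl//.
by apply: le_Rintegral => //; exact: integrable_abse ik.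
Qed.

Lemma Rintegral_normM_le u v : u \in Lfun mu 2%:E -> v \in Lfun mu 2%:E ->
  \int[mu]_y `|u y * v y| <= norm2 u * norm2 v.
Proof.
move=> u2 v2; rewrite -lee_fin EFinM !fineK_Lnorm// /Rintegral fineK.
  rewrite -[leLHS](Lnorm1 mu (EFin \o (u \* v))).
  apply: hoelder => //; [exact: measurable_Lfun u2|exact: measurable_Lfun v2|].
  by rewrite [RHS]splitr !div1r.
have iuv := (Lfun1_integrable mu _).1 (Lfun2_mul_Lfun1 u2 v2).
by apply: integrable_fin_num => //; exact: integrable_abse iuv.
Qed.

Lemma norm_hilbertM_le psi f x c : 0 < c ->
  (forall y, `|x - y| < c -> psi y = 0) ->
  psi \in Lfun mu 2%:E -> f \in Lfun mu 2%:E ->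
  `|hilbert (fun y => psi y * f y) x| <= c^-1 * (norm2 psi * norm2 f).
Proof.
move=> c0 psi0 psi2 f2; apply: le_trans (norm_hilbert_le c0 _ _) _.
- by move=> y /psi0 ->; rewrite mul0r.
- exact/Lfun1_integrable/Lfun2_mul_Lfun1.
- by rewrite ler_wpM2l ?invr_ge0 ?(ltW c0)//; exact: Rintegral_normM_le.
Qed.

Definition separated c phi psi :=
  forall x y, `|x - y| < c -> phi x * psi y = 0.

Lemma separatedC c phi psi : separated c phi psi -> separated c psi phi.
Proof. by move=> sep x y xy; rewrite mulrC sep// distrC. Qed.

Lemma separated_eq0 c phi psi x y : separated c phi psi -> phi x != 0 ->
  `|x - y| < c -> psi y = 0.
Proof. by move=> sep phix /sep/eqP; rewrite mulf_eq0 (negbTE phix) => /eqP. Qed.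

Lemma commH2_disjoint phi psi f x : (forall y, phi y * psi y = 0) ->
  commH2 phi psi f x = - (phi x * hilbert (fun y => psi y * f y) x)
                       - psi x * hilbert (fun y => phi y * f y) x.
Proof.
move=> disj; rewrite /commH2 /commH.
have -> : (fun y => psi y * (phi y * f y)) = fun=> 0.
  by apply/funext => y; rewrite mulrA (mulrC (psi y)) disj mul0r.
by rewrite hilbert0 subr0 mulrBr mulrA disj mul0r sub0r.
Qed.

Lemma norm_mul_hilbertM_le phi psi f x c : 0 < c -> separated c phi psi ->
  psi \in Lfun mu 2%:E -> f \in Lfun mu 2%:E ->
  `|phi x * hilbert (fun y => psi y * f y) x| <=
  c^-1 * norm2 f * `|norm2 psi * phi x|.
Proof.
move=> c0 sep psi2 f2.
have [->|phix] := eqVneq (phi x) 0; first by rewrite mul0r mulr0 normr0 mulr0.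
rewrite normrM [`|norm2 _ * _|]normrM (ger0_norm (fine_ge0 (Lnorm_ge0 _ _ _))).
rewrite mulrA mulrC ler_wpM2r// -mulrA [norm2 f * _]mulrC.
by apply: norm_hilbertM_le => // y; exact: separated_eq0 sep phix.
Qed.

(* At each point at most one of [phi] and [psi] is non-zero, hence at most one
   of the two summands on either side. *)
Lemma norm_commH2_separated_le phi psi f x c : 0 < c -> separated c phi psi ->
  phi \in Lfun mu 2%:E -> psi \in Lfun mu 2%:E -> f \in Lfun mu 2%:E ->
  `|commH2 phi psi f x| <=
  c^-1 * norm2 f * `|norm2 psi * phi x + norm2 phi * psi x|.
Proof.
move=> c0 sep phi2 psi2 f2.
have disj y : phi y * psi y = 0 by rewrite sep// subrr normr0.
rewrite (commH2_disjoint _ _ disj).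
have /eqP := disj x; rewrite mulf_eq0 => /orP[] /eqP x0; rewrite x0.
  rewrite mul0r oppr0 mulr0 !add0r normrN.
  exact: norm_mul_hilbertM_le (separatedC sep) _ _.
rewrite mul0r mulr0 subr0 addr0 normrN.
exact: norm_mul_hilbertM_le sep _ _.
Qed.

Lemma bounded_commH2_separated (phi psi : R -> R) (c : R) :
  0 < c -> separated c phi psi ->
  phi \in Lfun mu 2%:E -> psi \in Lfun mu 2%:E ->
  bounded_L2_on_Linf_c (commH2 phi psi).
Proof.
move=> c0 sep phi2 psi2.
pose g : LfunType mu (lee1n 2) :=
  norm2 psi *: Lfun_Sub (lee1n 2) phi2 + norm2 phi *: Lfun_Sub (lee1n 2) psi2.
exists (c^-1 * norm2 g) => f f_Linf_c.
have f2 : f \in Lfun mu 2%:E by exact: Linf_c_Lfun.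
have cf0 : 0 <= c^-1 * norm2 f.
  by rewrite mulr_ge0 ?invr_ge0 ?(ltW c0) ?fine_ge0 ?Lnorm_ge0.
apply: (@le_trans _ _
    'N[mu]_2%:E[EFin \o ((c^-1 * norm2 f) \*: (g : R -> R))])%E.
  apply: le_Lnorm => // x; rewrite /= lee_fin normrM (ger0_norm cf0).
  exact: norm_commH2_separated_le.
rewrite LnormZ (ger0_norm cf0) -finite_norm_fine -(fineK_Lnorm f2) -!EFinM.
by rewrite lee_fin mulrAC.
Qed.

End commutator_separated.

Section oscillation.
Variable R : realType.
Local Notation mu := (@lebesgue_measure R).
Implicit Types (b : R -> R) (a c d e r u v : R) (A B : set R).

Lemma osc_ge_dist_avg r b a c A d e : 0 < r -> a < c -> Linf_loc b ->
  measurable A -> A `<=` `[a, c] -> 0 <= d -> (d%:E <= mu A)%E -> 0 <= e ->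
  (forall x, A x -> e <= `|b x - avg b a c|) ->
  e * (d / (c - a)) `^ r^-1 <= osc r b a c.
Proof.
move=> r0 ac bloc mA Aac d0 dA e0 eb; have [r0' ca0] := (ltW r0, ltW ac).
rewrite -subr_ge0 in ca0.
pose dist x := `|b x - avg b a c| `^ r.
have idist : mu.-integrable `[a, c] (EFin \o dist).
  exact: Linf_loc_integrable_powR.
have dist0 x : (0 <= (EFin \o dist) x)%E by rewrite lee_fin powR_ge0.
have chebyshev : e `^ r * d <= \int[mu]_(x in `[a, c]) dist x.
  rewrite -lee_fin /Rintegral fineK ?integrable_fin_num// EFinM.
  apply: (@le_trans _ _ (\int[mu]_(x in A) (e `^ r)%:E)%E).
    by rewrite integral_cst// lee_wpmul2l// lee_fin powR_ge0.
  have mdist : measurable_fun `[a, c] (EFin \o dist) by case/integrableP: idist.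
  apply: (@le_trans _ _ (\int[mu]_(x in A) (EFin \o dist) x)%E).
    apply: ge0_le_integral => //; first by move=> x _; rewrite lee_fin powR_ge0.
      exact: measurable_funS mdist.
    by move=> x Ax; rewrite lee_fin ge0_ler_powR ?nnegrE ?eb.
  exact: ge0_subset_integral.
rewrite -[e in leLHS](powRr1 e0) -(mulfV (lt0r_neq0 r0)) powRrM.
rewrite -powRM ?powR_ge0 ?divr_ge0// /osc.
have int0 : 0 <= \int[mu]_(x in `[a, c]) dist x.
  by apply: Rintegral_ge0 => x _; exact: powR_ge0.
rewrite ge0_ler_powR ?nnegrE ?invr_ge0 ?mulr_ge0 ?powR_ge0 ?divr_ge0
  ?invr_ge0//.
by rewrite mulrA mulrC ler_wpM2l ?invr_ge0.
Qed.

Lemma osc_ge_jump r b a c A B d u v : 0 < r -> a < c -> Linf_loc b ->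
  measurable A -> measurable B -> A `<=` `[a, c] -> B `<=` `[a, c] ->
  0 <= d -> (d%:E <= mu A)%E -> (d%:E <= mu B)%E ->
  (forall x, A x -> b x = u) -> (forall x, B x -> b x = v) ->
  `|u - v| / 2 * (d / (c - a)) `^ r^-1 <= osc r b a c.
Proof.
move=> r0 ac bloc mA mB Aac Bac d0 dA dB bA bB; set m := avg b a c.
have : `|u - v| <= `|u - m| + `|v - m|.
  by rewrite (distrC v) (le_trans _ (ler_normD _ _))// subrKA.
have [um _|um uv] := leP (`|u - v| / 2) `|u - m|.
  by apply: (@osc_ge_dist_avg _ _ _ _ A) => // x /bA ->.
apply: (@osc_ge_dist_avg _ _ _ _ B) => // x /bB ->; rewrite -/m; lra.
Qed.

Lemma S_r_eqy r b1 b2 (a c : nat -> R) : (\forall k \near \oo, a k < c k) ->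
  osc r b1 (a k) (c k) @[k --> \oo] --> +oo ->
  osc r b2 (a k) (c k) @[k --> \oo] --> +oo ->
  S_r r b1 b2 = +oo%E.
Proof.
move=> ac /cvgryPge osc1 /cvgryPge osc2; apply: eq_infty => C.
have le_prod (u v : R) : Num.max 1 C <= u -> Num.max 1 C <= v -> C <= u * v.
  rewrite !ge_max => /andP[u_ge1 uC] /andP[v_ge1 _].
  by rewrite (le_trans uC)// ler_peMr// (le_trans _ u_ge1).
have [k [ack [osc1_ge osc2_ge]]] :=
  filter_ex (filterI ac (filterI (osc1 (Num.max 1 C)) (osc2 (Num.max 1 C)))).
apply: (@le_trans _ _ (osc r b1 (a k) (c k) * osc r b2 (a k) (c k))%:E).
  by rewrite lee_fin; exact: le_prod osc1_ge osc2_ge.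
by apply: ereal_sup_ubound; exists (a k), (c k).
Qed.

End oscillation.

Section spike_train.
Variables (R : realType) (h w : nat -> R).
Local Notation mu := (@lebesgue_measure R).
Hypothesis w_gt0 : forall k, 0 < w k.
Implicit Types (c s t x r p : R) (k n : nat).

Definition spike s k : set R := [set` `[k%:R + s, k%:R + s + w k]].

(* For [x < 0], [Num.truncn x] is [0], and [x] is outside [spike s 0] if
   [0 <= s]. *)
Definition spike_train s x : R :=
  h (Num.truncn x) * \1_(spike s (Num.truncn x)) x.

Lemma measurable_spike s k : measurable (spike s k).
Proof. exact: measurable_itv. Qed.

Lemma measurable_indic_spike s k :
  measurable_fun setT (\1_(spike s k) : R -> R).
Proof. exact: measurable_indic (measurable_spike s k). Qed.

Lemma measurable_spike_train s : measurable_fun setT (spike_train s).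
Proof.
apply: (measurable_fun_piecewise (@measurable_truncn R)
  (F := fun k x => h k * \1_(spike s k) x)) => k.
by apply: measurable_funM => //; exact: measurable_indic_spike.
Qed.

Lemma Linf_loc_spike_train s : Linf_loc (spike_train s).
Proof.
split=> [|a b]; first exact: measurable_spike_train.
exists (\sum_(k < (Num.truncn b).+1) `|h k|); apply: nearW => x.
rewrite in_itv/= => /andP[_ /le_truncn xb]; rewrite -ltnS in xb.
rewrite (bigD1 (Ordinal xb))//= -[leLHS]addr0 lerD ?sumr_ge0//.
by rewrite normrM indicE; case: (_ \in _);
  rewrite ?normr1 ?normr0 ?mulr1 ?mulr0.
Qed.

Lemma separated_spike_train s t c :
  (forall k, s + w k + c <= t) -> (forall k, t + w k + c <= 1 + s) ->
  separated c (spike_train s) (spike_train t).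
Proof.
move=> st ts x y; rewrite ltr_norml => /andP[xy1 xy2]; apply/eqP.
rewrite /spike_train !indicE.
case: (boolP (x \in _)) => [|_]; last by rewrite mulr0 mul0r.
case: (boolP (y \in _)) => [|_]; last by rewrite !mulr0.
rewrite !inE /spike/= !in_itv/= => /andP[ly yl] /andP[kx xk].
move: (Num.truncn x) (Num.truncn y) => k l in ly yl kx xk *.
have [stk tsl] := (st k, ts l).
have [kl|lk] := leqP k l.
  by move: kl; rewrite -(ler_nat R); lra.
by move: lk; rewrite -(ler_nat R) -natr1; lra.
Qed.

Lemma lebesgue_measure_spike s k : mu (spike s k) = (w k)%:E.
Proof.
rewrite /spike lebesgue_measure_itv/= lte_fin ltrDl w_gt0.
by rewrite -EFinB addrAC subrr add0r.
Qed.

Lemma spike_trainE s k x : k%:R <= x < k.+1%:R ->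
  spike_train s x = h k * \1_(spike s k) x.
Proof. by move=> kx; rewrite /spike_train (truncn_def kx). Qed.

Lemma spike_subset_cell s k : 0 <= s -> s + w k < 1 ->
  spike s k `<=` Num.truncn @^-1` [set k].
Proof.
move=> s0 sw1 x; rewrite /spike/= in_itv/= => /andP[kx xk]; apply: truncn_def.
by rewrite -natr1; apply/andP; split; lra.
Qed.

Lemma integral_spike_train_powR s p :
  0 < p -> 0 <= s -> (forall k, s + w k < 1) ->
  (\int[mu]_x (`|spike_train s x| `^ p)%:E =
   \sum_(k <oo) (`|h k| `^ p * w k)%:E)%E.
Proof.
move=> p0 s0 sw1; pose F k x := ((`|h k| `^ p)%:E * (\1_(spike s k) x)%:E)%E.
have mF k : measurable_fun setT (F k).
  apply/measurable_EFinP; apply: measurable_funM => //.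
  exact: measurable_indic_spike.
have F0 k x : (0 <= F k x)%E by rewrite mule_ge0 ?lee_fin ?powR_ge0.
transitivity (\int[mu]_x F (Num.truncn x) x)%E.
  apply: eq_integral => x _; rewrite /F -EFinM /spike_train normrM powRM//.
  by rewrite indicE; case: (_ \in _);
    rewrite ?normr1 ?normr0 ?powR1 ?powR0 ?gt_eqF.
rewrite (@ge0_integral_piecewise _ (measurableTypeR R) _ (@measurable_truncn R)
  _ mu _ mF F0).
apply: eq_eseriesr => k _.
have mcell : measurable (@Num.truncn R @^-1` [set k]).
  by rewrite -[X in measurable X]setTI; exact: measurable_truncn.
rewrite ge0_integralZl_EFin ?powR_ge0//; last first.
  by apply/measurable_EFinP/measurable_funTS; exact: measurable_indic_spike.
rewrite integral_indic//; last exact: measurable_spike.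
rewrite setIidl/= ?lebesgue_measure_spike ?EFinM//.
exact: spike_subset_cell.
Qed.

Lemma Lfun_spike_train s p : 0 < p -> 0 <= s -> (forall k, s + w k < 1) ->
  (\sum_(k <oo) (`|h k| `^ p * w k)%:E < +oo)%E ->
  spike_train s \in Lfun mu p%:E.
Proof.
move=> p0 s0 sw1 sum_lty; apply: integral_powR_lty_Lfun => //.
  exact: measurable_spike_train.
by rewrite integral_spike_train_powR.
Qed.

Lemma osc_spike_train_ge s r k : 0 < r -> 0 <= s -> s + 2 * w k <= 1 ->
  `|h k| / 2 * w k `^ r^-1 <= osc r (spike_train s) k%:R k.+1%:R.
Proof.
move=> r0 s0 sw1; have wk := w_gt0 k.
pose gap := [set` `]k%:R + s + w k, k%:R + s + 2 * w k[].
have mu_gap : mu gap = (w k)%:E.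
  rewrite /gap lebesgue_measure_itv/= lte_fin ifT -?EFinB; last by lra.
  by congr EFin; ring.
have := @osc_ge_jump R r (spike_train s) k%:R k.+1%:R
  (spike s k) gap (w k) (h k) 0.
rewrite subr0 -natr1 [_ + 1 - _]addrAC subrr add0r divr1; apply=> //.
- by rewrite ltrDl.
- exact: Linf_loc_spike_train.
- exact: measurable_spike.
- exact: measurable_itv.
- by move=> x; rewrite /spike/= !in_itv/= => /andP[? ?]; apply/andP; split; lra.
- by move=> x; rewrite /gap/= !in_itv/= => /andP[? ?]; apply/andP; split; lra.
- exact: ltW.
- by rewrite lebesgue_measure_spike.
- by rewrite mu_gap.
- move=> x xk.
  have := xk; rewrite /spike/= in_itv/= => /andP[? ?].
  rewrite (@spike_trainE _ k); last by rewrite -natr1; apply/andP; split; lra.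
  by rewrite indicE mem_set// mulr1.
- move=> x; rewrite /gap/= in_itv/= => /andP[? ?].
  rewrite (@spike_trainE _ k); last by rewrite -natr1; apply/andP; split; lra.
  rewrite indicE memNset ?mulr0// /spike/= in_itv/= => /andP[? ?]; lra.
Qed.

Lemma osc_spike_train_cvgy s r :
  0 < r -> 0 <= s -> (forall k, s + 2 * w k <= 1) ->
  `|h k| `^ r * w k @[k --> \oo] --> +oo ->
  osc r (spike_train s) k%:R k.+1%:R @[k --> \oo] --> +oo.
Proof.
move=> r0 s0 sw1 /cvgryPge mass; apply/cvgryPge => C.
apply: filterS (mass ((2 * `|C|) `^ r)) => k massk.
apply: le_trans (osc_spike_train_ge r0 s0 (sw1 k)).
have powRK x : 0 <= x -> (x `^ r) `^ r^-1 = x.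
  by move=> x0; rewrite -powRrM mulfV ?gt_eqF// powRr1.
rewrite -[`|h k|]powRK// mulrAC -powRM ?powR_ge0 ?(ltW (w_gt0 k))//
  ler_pdivlMr// mulrC.
apply: (@le_trans _ _ (2 * `|C|)); first by rewrite ler_pM2l// ler_norm.
rewrite -[leLHS]powRK ?mulr_ge0//.
by rewrite ge0_ler_powR ?nnegrE ?invr_ge0 ?(ltW r0) ?mulr_ge0 ?powR_ge0
  ?(ltW (w_gt0 k)).
Qed.

End spike_train.

Section tall_spikes.
Variable R : realType.
Local Notation mu := (@lebesgue_measure R).
Implicit Types (k : nat) (eps s : R).

(* [tall_height k ^+ 2 * tall_width k] is [2 ^- k.+2], hence summable, while
   [tall_height k `^ eps = (2 ^+ k.+2) `^ (k%:R * eps)] dominates any geometric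
   sequence. *)
Definition tall_height k : R := (2 ^+ k.+2) ^+ k.

Definition tall_width k : R := (2 ^+ k.+2)^-1 / tall_height k ^+ 2.

Definition tall_spikes : R -> R -> R := spike_train tall_height tall_width.

Lemma tall_height_gt0 k : 0 < tall_height k.
Proof. by rewrite !exprn_gt0. Qed.

Lemma tall_width_gt0 k : 0 < tall_width k.
Proof. by rewrite divr_gt0 ?invr_gt0 ?exprn_gt0 ?tall_height_gt0. Qed.

Lemma tall_width_le k : tall_width k <= 4^-1.
Proof.
have q_ge4 : 4 <= 2 ^+ k.+2 :> R.
  by rewrite -natrX (ler_nat _ 4) (@leq_exp2l 2 2).
have h2_ge1 : 1 <= tall_height k ^+ 2 by rewrite !exprn_ege1// ler1n.
have qh_ge4 : 4 <= 2 ^+ k.+2 * tall_height k ^+ 2 by nra.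
by rewrite /tall_width -invfM lef_pV2 ?posrE// (lt_le_trans _ qh_ge4).
Qed.

Lemma tall_height_sqr_width k :
  `|tall_height k| `^ 2 * tall_width k = 2^-1 / (2 ^ k.+1)%:R.
Proof.
rewrite powR_mulrn// real_normK ?num_real// /tall_width mulrCA mulfV.
  by rewrite mulr1 natrX -invfM -exprS.
by rewrite expf_neq0// gt_eqF// tall_height_gt0.
Qed.

Lemma tall_height_powR_width_cvgy eps : 0 < eps ->
  `|tall_height k| `^ (2 + eps) * tall_width k @[k --> \oo] --> +oo.
Proof.
move=> eps0; apply/cvgryPge => C.
apply: filterS2 (nbhs_infty_ger C) (nbhs_infty_ger (2 / eps)) => k C_le.
rewrite ler_pdivrMr// => keps_ge2.
pose q : R := 2 ^+ k.+2; have q0 : 0 < q by rewrite exprn_gt0.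
have k_le_q : k%:R <= q.
  by rewrite /q -natrX ler_nat (leq_trans (leqW (leqnSn k)))// ltnW// ltn_expl.
apply: le_trans C_le _; apply: le_trans k_le_q _.
have q_le : q ^+ 2 <= tall_height k `^ eps.
  rewrite /tall_height -/q -(powR_mulrn 2 (ltW q0)) -(powR_mulrn k (ltW q0)).
  by rewrite -powRrM ler_powR// exprn_ege1// ler1n.
have h0 := tall_height_gt0 k.
rewrite gtr0_norm// powRD ?(gt_eqF h0) ?implybT// (powR_mulrn 2 (ltW h0)).
rewrite /tall_width -/q.
set h := tall_height k in q_le h0 *.
have -> : h ^+ 2 * h `^ eps * (q^-1 / h ^+ 2) = h `^ eps / q.
  by field; rewrite !gt_eqF.
by rewrite ler_pdivlMr// -expr2.
Qed.

Lemma Lfun_tall_spikes s : 0 <= s -> s <= 2^-1 ->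
  tall_spikes s \in Lfun mu 2%:E.
Proof.
move=> s0 s_le; apply: Lfun_spike_train => //; first exact: tall_width_gt0.
  by move=> k; have := tall_width_le k; lra.
under eq_eseriesr do rewrite tall_height_sqr_width.
by apply: le_lt_trans (epsilon_trick0 _ _) (ltry _); rewrite invr_ge0.
Qed.

Lemma osc_tall_spikes_cvgy eps s : 0 < eps -> 0 <= s -> s <= 2^-1 ->
  osc (2 + eps) (tall_spikes s) k%:R k.+1%:R @[k --> \oo] --> +oo.
Proof.
move=> eps0 s0 s_le; apply: osc_spike_train_cvgy => //.
- exact: tall_width_gt0.
- by rewrite addr_gt0.
- by move=> k; have := tall_width_le k; lra.
- exact: tall_height_powR_width_cvgy.
Qed.

Lemma separated_tall_spikes : separated 4^-1 (tall_spikes 2^-1) (tall_spikes 0).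
Proof.
by apply/separatedC/separated_spike_train => k; have := tall_width_le k; lra.
Qed.

End tall_spikes.

Theorem theorem4p3 (R : realType) :
  exists psi phi : R -> R,
    Linf_loc psi /\ Linf_loc phi /\
    (forall eps : R, 0 < eps -> S_r (2 + eps) psi phi = +oo%E) /\
    bounded_L2_on_Linf_c (commH2 phi psi).
Proof.
exists (tall_spikes 0), (tall_spikes 2^-1).
split; first exact: Linf_loc_spike_train.
split; first exact: Linf_loc_spike_train.
split=> [eps eps0|].
  apply: (S_r_eqy (a := fun k => k%:R) (c := fun k => k.+1%:R)).
  - by apply: nearW => k; rewrite ltr_nat.
  - exact: osc_tall_spikes_cvgy.
  - exact: osc_tall_spikes_cvgy.
by apply: bounded_commH2_separated (@separated_tall_spikes R) _ _ => //;
  exact: Lfun_tall_spikes.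
Qed.
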